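(* Let $\mathbb{F}$ be a field, let $V$ be an infinite-dimensional vector space over $\mathbb{F}$, and let $p_1,p_2,p_3\in\mathbb{F}[t]$ be split polynomials of degree $2$. Let $u$ be an endomorphism of $V$ with a dominant eigenvalue $\lambda$ such that $u-\lambda\,\mathrm{id}_V$ has infinite rank. Assume that $\lambda$ is a $(p_1,p_2,p_3)$-sum or $2\lambda=\operatorname{tr}p_1+\operatorname{tr}p_2+\operatorname{tr}p_3$. Then $u$ is a $(p_1,p_2,p_3)$-sum.
   Context: A scalar $\lambda$ is a dominant eigenvalue of $u\in\mathrm{End}(V)$ if $\operatorname{rk}(u-\lambda\,\mathrm{id}_V)<\dim V$. An endomorphism $u$ is a $(p_1,p_2,p_3)$-sum if $u=u_1+u_2+u_3$ for some endomorphisms $u_k$ of $V$ with $p_k(u_k)=0$ for all $k$. A scalar $\lambda$ is a $(p_1,p_2,p_3)$-sum if $\lambda=x_1+x_2+x_3$ for some $x_k\in\mathbb{F}$ with $p_k(x_k)=0$ for all $k$. The trace of a monic polynomial of degree $n>0$ is the opposite of its coefficient on $t^{n-1}$; the trace $\operatorname{tr}p$ of a nonconstant polynomial $p$ with leading coefficient $\alpha$ is the trace of $\alpha^{-1}p$. *)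

(* Defs.v *)
(* Possibly infinite-dimensional vector spaces are modelled as
   an arbitrary left module V : lmodType F over a field F; subsets of V are
   predicates V -> Prop; dimensions/ranks are compared through bases. *)
From HB Require Import structures.
From mathcomp Require Import all_boot all_order all_algebra.
Set Implicit Arguments. Unset Strict Implicit. Unset Printing Implicit Defensive.
Import Order.TTheory GRing.Theory Num.Theory.
Local Open Scope ring_scope.

Section Defs.
Variables (F : fieldType) (V : lmodType F).

Definition lin_indep (A : V -> Prop) : Prop :=
  forall (s : seq V) (c : V -> F), uniq s -> (forall x, x \in s -> A x) ->
    \sum_(x <- s) c x *: x = 0 -> forall x, x \in s -> c x = 0.

Definition basis_of (W A : V -> Prop) : Prop :=
  [/\ forall x, A x -> W x,
      lin_indep A &
      forall w, W w -> exists (s : seq V) (c : V -> F),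
          (forall x, x \in s -> A x) /\ w = \sum_(x <- s) c x *: x].

Definition card_le (A B : V -> Prop) : Prop :=
  exists f : V -> V, (forall x, A x -> B (f x)) /\
    (forall x y, A x -> A y -> f x = f y -> x = y).
Definition card_lt (A B : V -> Prop) : Prop := card_le A B /\ ~ card_le B A.

Definition range_of (f : V -> V) : V -> Prop := fun w => exists v, w = f v.

Definition rank_lt_dim (f : V -> V) : Prop :=
  exists A B, [/\ basis_of (range_of f) A, basis_of (fun _ => True) B & card_lt A B].

Definition infinite_dim (W : V -> Prop) : Prop :=
  forall n : nat, exists s : seq V,
    [/\ size s = n, uniq s, forall x, x \in s -> W x & lin_indep (fun x => x \in s)].

Definition shift (u : V -> V) (lambda : F) : V -> V := fun v => u v - lambda *: v.

Definition dominant_eigenvalue (u : V -> V) (lambda : F) : Prop :=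
  rank_lt_dim (shift u lambda).

Definition peval (p : {poly F}) (f : V -> V) : V -> V :=
  fun v => \sum_(i < size p) p`_i *: iter i f v.

Definition is_sum3 (p1 p2 p3 : {poly F}) (u : {linear V -> V}) : Prop :=
  exists u1 u2 u3 : {linear V -> V},
    [/\ forall v, u v = u1 v + u2 v + u3 v,
        forall v, peval p1 u1 v = 0,
        forall v, peval p2 u2 v = 0 &
        forall v, peval p3 u3 v = 0].
End Defs.

Definition scalar_sum3 (F : fieldType) (p1 p2 p3 : {poly F}) (lambda : F) : Prop :=
  exists x1 x2 x3, [/\ root p1 x1, root p2 x2, root p3 x3 & lambda = x1 + x2 + x3].

Definition split_poly (F : fieldType) (p : {poly F}) : Prop :=
  exists s : seq F, p = lead_coef p *: \prod_(a <- s) ('X - a%:P).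

(* trace of a nonconstant polynomial: minus the coefficient on t^(n-1) of the
   monic normalization *)
Definition ptrace (F : fieldType) (p : {poly F}) : F :=
  - (p`_(size p).-2 / lead_coef p).

(* Main.v *)
(* Write u = lambda + w and let R be the range of w.  As dim R < dim V, there is
   a lift of R through w that is independent from R; completing inside Ker w
   gives V = M x M x N with M = R, N infinite-dimensional, and
   w (x, y, n) = (0, x + B y, 0) for some endomorphism B of M.

   On a square M x M, let p_k have roots a_k, b_k.  Subtracting a block upper
   triangular map with diagonal a_2, b_2 and a block lower triangular one with
   diagonal a_3, b_3 absorbs the off-diagonal blocks, and the remainder can be
   taken to be similar to a companion block matrix of p_1 as soon as its
   diagonal blocks are P and a_1 + b_1 - g P g^-1 for some automorphism g.

   On N the map is the scalar lambda: it is a sum of three scalars, or, when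
   2 lambda is the sum of the traces, N is a square N' x N' and the block
   criterion applies with g = id.  On M x M, conjugating by a shear turns the
   diagonal blocks into lambda + T and lambda + B - T with T arbitrary, so the
   criterion asks for T similar to T - B', where B' = B + (2 lambda - trace sum).
   Such a T exists for every endomorphism B' of an infinite-dimensional space:
   in a suitable well-ordered basis, let T shift the basis vectors far above
   everything B' produces from them; T and T - B' then have the same leading
   terms, and the map x_(f^n i) |-> (T - B')^n x_i is unitriangular. *)
From HB Require Import structures.
From mathcomp Require Import all_boot all_order all_algebra.
From mathcomp Require Import finmap ring.
From mathcomp.multinomials Require Import monalg.
From mathcomp Require Import boolp classical_sets functions cardinality wochoice.
Require Import Defs.
Set Implicit Arguments. Unset Strict Implicit. Unset Printing Implicit Defensive.
Import GRing.Theory.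

(** * Infinite sets *)

Definition embeds (S T : Type) := exists f : S -> T, injective f.

Lemma embeds_trans (S T U : Type) : embeds S T -> embeds T U -> embeds S U.
Proof. by move=> [f fI] [g gI]; exists (g \o f); apply: inj_comp. Qed.

Lemma bijectiveT (S T : Type) (f : S -> T) :
  injective f -> (forall y, exists x, f x = y) -> bijective f.
Proof.
move=> fI fS; have [g gP] := choice fS.
by exists g => // x; apply: fI; rewrite gP.
Qed.

(** Choose a new element of [P] outside the finite list of earlier choices; [L n] lists the first
    [n] of them. *)
Lemma nat_embeds_sub (T : choiceType) (P : T -> Prop) :
  (forall s : seq T, exists2 t, P t & t \notin s) ->
  exists2 g : nat -> T, injective g & forall n, P (g n).
Proof.
move=> H; have H' (s : seq T) : exists t, P t /\ t \notin s.
  by have [t] := H s; exists t.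
have [nx nxP] := choice H'.
pose fix L n := if n is k.+1 then nx (L k) :: L k else [::].
have memL m n : (m < n)%N -> nx (L m) \in L n.
  elim: n => // n IH; rewrite ltnS leq_eqVlt => /orP[/eqP->|/IH h] /=.
    exact: mem_head.
  by rewrite in_cons h orbT.
exists (fun n => nx (L n)) => [m n e|n]; last by case: (nxP (L n)).
apply/eqP; case: ltngtP => // /memL.
  by rewrite e => h; have [_ /negP] := nxP (L n).
by rewrite -e => h; have [_ /negP] := nxP (L m).
Qed.

(** A maximal family of injective sequences with disjoint ranges, given by Zorn, misses only
    finitely many points. One sequence of the family absorbs these, and the family itself serves as
    [J]. *)
Lemma nat_partition (T : choiceType) : embeds nat T ->
  exists (J : choiceType) (f : J * nat -> T), bijective f.
Proof.
move=> [h hI].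
pose P (X : set (nat -> T)) := (forall g, X g -> injective g) /\
  (forall g g' m n, X g -> X g' -> g m = g' n -> g = g').
have [|X [[X1 X2] Xmax]] := @Zorn_bigcup _ P.
  move=> C CP Ctot; split=> [g [X CX Xg]|g g' m n [X CX Xg] [Y CY Yg']].
    by have [PX _] := CP _ CX; exact: PX.
  case: (Ctot X Y CX CY) => sub.
    by have [_ PY] := CP _ CY; apply: PY => //; exact: sub.
  by have [_ PX] := CP _ CX; apply: PX => //; exact: sub.
(* If no finite list contained the missed points, a further sequence could be drawn from them,
   against maximality. *)
have [s sP] : exists s : seq T, forall t, (forall g n, X g -> g n <> t) -> t \in s.
  apply: contrapT => /forallNP ns.
  have [|g gI gP] := @nat_embeds_sub T (fun t => forall g n, X g -> g n <> t).
    move=> s; have /existsNP[t /not_implyP[tP /negP ts]] := ns s.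
    by exists t.
  apply: (Xmax (X `|` [set g])%classic).
    rewrite properEneq; split; last by left.
    apply/eqP => e; have : X g by rewrite e; right.
    by move=> Xg; exact: (gP 0%N g 0%N Xg).
  split=> [_ [/X1//|->//]|g1 g2 m n [Xg1|->] [Xg2|->]] //.
  - exact: X2.
  - by move=> e; have := gP n _ _ Xg1 e.
  - by move=> e; have := gP m _ _ Xg2 (esym e).
have {s sP} [s [us sP]] : exists s : seq T, uniq s /\
    forall t, (t \in s) = `[< forall g n, X g -> g n <> t >].
  exists (undup [seq t <- s | `[< forall g n, X g -> g n <> t >]]).
  split=> [|t]; first exact: undup_uniq.
  rewrite mem_undup mem_filter; case: asboolP => //= tP.
  by rewrite sP.
have [g0 Xg0] : exists g, X g.
  apply: contrapT => /forallNP X0.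
  have hs n : h n \in s by rewrite sP; apply/asboolP => g m /X0.
  have : (size [seq h i | i <- iota 0 (size s).+1] <= size s)%N.
    apply: uniq_leq_size; first by rewrite map_inj_uniq ?iota_uniq.
    by move=> _ /mapP[i _ ->].
  by rewrite size_map size_iota ltnn.
have t0 := g0 0%N.
(* The finite set [s] missed by the maximal family is prepended to [g0]. *)
pose f (x : {g : {classic nat -> T} | `[<X g>]} * nat) :=
  if `[< sval x.1 = g0 >] then
    if (x.2 < size s)%N then nth t0 s x.2 else g0 (x.2 - size s)%N
  else sval x.1 x.2.
have XP (g : {g : {classic nat -> T} | `[<X g>]}) : X (sval g).
  by apply/asboolP/(svalP g).
have nths n : (n < size s)%N -> forall g m, X g -> g m <> nth t0 s n.
  by move=> ns; apply/asboolP; rewrite -sP mem_nth.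
have fg (x : {g : {classic nat -> T} | `[<X g>]} * nat) :
    (exists n, f x = sval x.1 n) \/ (sval x.1 = g0 /\ f x \in s).
  rewrite /f; case: asboolP => [e|_]; last by left; eexists.
  case: ifP => [h'|_]; first by right; rewrite mem_nth.
  by left; exists (x.2 - size s)%N; rewrite e.
exists {g : {classic nat -> T} | `[<X g>]}, f; apply: bijectiveT.
- move=> [g m] [g' n] e.
  have gg' : g = g'.
    apply: val_inj => /=.
    have := fg (g, m); have := fg (g', n); rewrite e /=.
    move=> [[k ->]|[-> ins]] [[l]|[-> ins']] //.
    + by move=> /esym; exact: X2.
    + by move: ins'; rewrite sP => /asboolP/(_ _ k (XP g')).
    + by move=> e'; move: ins; rewrite e' sP => /asboolP/(_ _ l (XP g)).
  subst g'; congr pair; move: e; rewrite /f /=; case: asboolP => _; last first.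
    exact: X1.
  case: ifP => ms; case: ifP => ns.
  + by move=> /eqP; rewrite nth_uniq // => /eqP.
  + by move=> /esym /(nths _ ms _ _ Xg0).
  + by move=> /(nths _ ns _ _ Xg0).
  + move=> /X1 -/(_ Xg0) e.
    have {}ms : (size s <= m)%N by rewrite leqNgt ms.
    have {}ns : (size s <= n)%N by rewrite leqNgt ns.
    by rewrite -(subnK ms) -(subnK ns) e.
- move=> t.
  have Xb g : X g -> `[<X g>] by move=> ?; apply/asboolP.
  case ts : (t \in s).
    exists (exist _ g0 (Xb _ Xg0), index t s); rewrite /f /=.
    by rewrite asboolT // index_mem ts nth_index.
  move: ts; rewrite sP => /asboolP /existsNP[g /existsNP[n /not_implyP[Xg]]].
  move=> /contrapT <-.
  have [gg0|ne] := pselect (g = g0).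
    exists (exist _ g0 (Xb _ Xg0), n + size s)%N; rewrite /f /=.
    by rewrite asboolT // ltnNge leq_addl /= addnK gg0.
  by exists (exist _ g (Xb _ Xg), n); rewrite /f /= asboolF.
Qed.

(** Writing [T] as [J * nat] reduces the claim to a pairing function on [nat]. *)
Lemma embeds_prod_nat (T : choiceType) : embeds nat T -> embeds (T * nat) T.
Proof.
move=> /nat_partition[J [f fb]]; have [g fK gK] := fb.
exists (fun x => f ((g x.1).1, choice.pickle ((g x.1).2, x.2))).
move=> [x m] [y n] /= /(bij_inj fb) [e1 /(pcan_inj choice.pickleK) [e2 ->]].
by congr pair; rewrite -(gK x) -(gK y) (surjective_pairing (g x)) e1 e2 -surjective_pairing.
Qed.

(** Comparability of cardinals: a maximal partial injection, seen as its graph [G], is total on one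
    side or onto the other, since otherwise an unmatched pair could be added. *)
Lemma embeds_total (S T : Type) : embeds S T \/ embeds T S.
Proof.
pose P (G : set (S * T)) := forall x y, G x -> G y -> x.1 = y.1 <-> x.2 = y.2.
have [|G [GP Gmax]] := @Zorn_bigcup _ P.
  move=> C CP Ctot x y [X CX Xx] [Y CY Yy].
  case: (Ctot X Y CX CY) => sub.
    by apply: (CP _ CY) => //; exact: sub.
  by apply: (CP _ CX) => //; exact: sub.
have [domS|] := pselect (forall s, exists t, G (s, t)).
  left; have [f fP] := choice domS.
  by exists f => x y e; apply: (GP _ _ (fP x) (fP y)).2.
move=> /existsNP[s /forallNP sP].
right; have codT t : exists s, G (s, t).
  apply: contrapT => /forallNP tP.
  apply: (Gmax (G `|` [set (s, t)])%classic).
    rewrite properEneq; split; last by left.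
    apply/eqP => e; apply: (sP t); rewrite e; right => //.
  move=> [s1 t1] [s2 t2] [G1|[-> ->]] [G2|[-> ->]] //=; first exact: (GP _ _ G1 G2).
    by split=> e; [case: (sP t1); rewrite -e|case: (tP s1); rewrite -e].
  by split=> e; [case: (sP t2); rewrite e|case: (tP s2); rewrite e].
have [f fP] := choice codT.
by exists f => x y e; apply: (GP _ _ (fP x) (fP y)).1.
Qed.

Lemma nat_bijection (T : choiceType) : embeds nat T -> embeds T nat ->
  exists f : nat -> T, bijective f.
Proof.
move=> [h hI] [k kI].
have : ([set: T] #= [set: nat])%card.
  apply: Cantor_Bernstein; first by apply/countable_injP; exists k => x y _ _; exact: kI.
  have : (h @` [set: nat] #= [set: nat])%card.
    by apply: inj_card_eq => x y _ _; exact: hI.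
  rewrite card_eq_le => /andP[_ le]; apply: card_le_trans le _.
  exact: subset_card_le.
move=> /card_set_bijP[f]; rewrite setTT_bijective => -[g fK gK].
by exists g, f.
Qed.

Lemma fiber_enumeration (T K : choiceType) (rho : T -> K) :
  (forall t, embeds nat {x | rho x == rho t}) ->
  (forall t, embeds {x | rho x == rho t} nat) ->
  exists (J : choiceType) (v : J -> K) (theta : J * nat -> T),
    [/\ injective v, bijective theta & forall x, rho (theta x) = v x.1].
Proof.
move=> inf ctb; pose J := {k : K | `[< exists t, rho t = k >]}.
have H (j : J) : exists f : nat -> T, [/\ injective f, forall n, rho (f n) = sval j &
    forall t, rho t = sval j -> exists n, f n = t].
  have [t tj] : exists t, rho t = sval j by apply/asboolP/(svalP j).
  have [f fb] := nat_bijection (inf t) (ctb t); have [g fK gK] := fb.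
  exists (sval \o f); split=> [m n /val_inj/(can_inj fK)//|n|t' e].
    by rewrite /= -tj; apply/eqP/(svalP (f n)).
  have ht : rho t' == rho t by rewrite e tj.
  by exists (g (exist _ t' ht)); rewrite /= gK.
have [F FP] := choice H; exists J, sval, (fun x => F x.1 x.2); split.
- exact: val_inj.
- apply: bijectiveT => [[i m] [j n] /= e|t].
    have ij : i = j.
      apply: val_inj; case: (FP i) (FP j) => _ /(_ m) ei _ [_ /(_ n) ej _].
      by rewrite -[LHS]ei -[RHS]ej e.
    by subst j; have [I _ _] := FP i; rewrite (I _ _ e).
  have ht : `[< exists t', rho t' = rho t >] by apply/asboolP; exists t.
  have [_ _ /(_ t erefl)[n nt]] := FP (exist _ (rho t) ht).
  by exists (exist _ (rho t) ht, n).
- by move=> [j n]; have [_ + _] := FP j; exact.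
Qed.

(* The closure of a single block under [succ] is countable; assigning to each
   block the least block whose closure contains it makes every fiber a
   countable union of blocks, and [succ] can only decrease the assignment. *)
Lemma stratification (T : choiceType) (succ : T -> seq T) : embeds nat T ->
  exists (J : choiceType) (lt : J -> J -> Prop) (theta : J * nat -> T),
    [/\ bijective theta, well_founded lt,
        (forall i j k, lt i j -> lt j k -> lt i k),
        (forall i j, [\/ lt i j, i = j | lt j i]) &
        forall x y, theta y \in succ (theta x) -> lt y.1 x.1 \/ y.1 = x.1].
Proof.
move=> /nat_partition[K [tau taub]]; have [tau' tauK tau'K] := taub.
(* With [c = (m, n)], [step] goes from the block [k] to the block of the [n]-th successor of its
   [m]-th element, and stays at [k] when [n] is out of range. Thus [cl j k] means that [k] is
   reachable from [j]. *)
pose step (k : K) (c : nat * nat) : K :=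
  if (c.2 < size (succ (tau (k, c.1))))%N
  then (tau' (nth (tau (k, 0%N)) (succ (tau (k, c.1))) c.2)).1 else k.
pose cl j k := exists s, foldl step j s = k.
have clt i j k : cl i j -> cl j k -> cl i k.
  by move=> [s <-] [t <-]; exists (s ++ t); rewrite foldl_cat.
have clE j x y : cl j (tau' x).1 -> y \in succ x -> cl j (tau' y).1.
  move=> jx yx; apply: clt jx _; exists [:: ((tau' x).2, index y (succ x))].
  by rewrite /= /step /= -surjective_pairing tau'K index_mem yx nth_index.
have [R woR] := well_ordering_principle K.
have Rtot : total R by move=> x y; apply: (@wo_chainW _ R predT) => // A _; exact: woR.
have Rrefl : reflexive R by move=> x; have := Rtot x x; rewrite orbb.
have Ranti : antisymmetric R.
  move=> x y; apply: (@wo_chain_antisymmetric _ R predT) => // A _; exact: woR.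
have /choice[r rP] (k : K) : exists j, cl j k /\ forall i, cl i k -> R j i.
  have [|j [[jk jmin] _]] := woR [pred j | `[< cl j k >]].
    by exists k; apply/asboolP; exists [::].
  exists j; split; first exact/asboolP.
  by move=> i ik; apply: jmin; exact/asboolP.
(* Transitivity comes from the least element of the three-point set and antisymmetry. *)
have Rtr : transitive R.
  move=> j i k ij jk.
  have [|z [[]]] := woR [pred x | (x == i) || (x == j) || (x == k)].
    by exists i; rewrite inE eqxx.
  rewrite inE => + zmin _; have [zi zj zk] : [/\ R z i, R z j & R z k].
    by split; apply: zmin; rewrite inE eqxx ?orbT.
  move=> /orP[/orP[]|] /eqP e; subst z => //.
    by rewrite (Ranti i j) // ij zi.
  by rewrite (Ranti k j) // jk zj.
pose rho t := r (tau' t).1.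
have [||J [v [theta [vI thb thv]]]] := @fiber_enumeration T K rho.
- move=> t; pose f n := tau ((tau' t).1, n).
  have fP n : rho (f n) == rho t by rewrite /rho /f tauK.
  exists (fun n => exist _ (f n) (fP n)) => m n [].
  by move/(can_inj tauK) => [].
- move=> t; have /choice[S SP] (x : {x | rho x == rho t}) :
      exists s, foldl step (rho t) s = (tau' (sval x)).1.
    by have := (rP (tau' (sval x)).1).1; rewrite -/(rho _) (eqP (svalP x)).
  (* An element of the fiber is determined by a finite path from the common value of [rho] to its
     block and by its position in that block; there are countably many such data. *)
  exists (fun x => choice.pickle (S x, (tau' (sval x)).2)) => x y.
  move=> /(pcan_inj choice.pickleK)[e1 e2]; apply/val_inj/(can_inj tau'K) => /=.
  rewrite (surjective_pairing (tau' (sval x))) (surjective_pairing (tau' (sval y))).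
  by rewrite -!SP e1 e2.
exists J, (fun i j => R (v i) (v j) /\ i <> j), theta; split; first exact: thb.
- move=> j; apply: contrapT => nj.
  have [|k [[]]] := woR [pred k |
      `[< exists j, v j = k /\ ~ Acc (fun i j => R (v i) (v j) /\ i <> j) j >]].
    by exists (v j); apply/asboolP; exists j.
  move=> /asboolP[i [<- ni]] imin _; apply: ni; constructor => l [li ne].
  apply: contrapT => nl; apply: ne; apply/vI/Ranti; rewrite li /=.
  by apply: imin; apply/asboolP; exists l.
- move=> i j k [ij nij] [jk njk]; split; first exact: Rtr ij jk.
  by move=> e; apply: nij; apply/vI/Ranti; rewrite ij e jk.
- move=> i j; have [->|ne] := pselect (i = j); first by constructor 2.
  have /orP[h|h] := Rtot (v i) (v j); first by constructor 1.
  by constructor 3; split=> // e; apply: ne.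
- move=> x y yx; have [->|ne] := pselect (y.1 = x.1); first by right.
  left; split=> //; rewrite -!thv; apply: (rP _).2.
  by apply: clE yx; exact: (rP _).1.
Qed.

Local Open Scope ring_scope.

(** * Free modules *)

Section FreeModule.
Variable F : fieldType.

Lemma linear_packing (U V : lmodType F) (f : U -> V) :
  linear f -> exists g : {linear U -> V}, g =1 f.
Proof.
move=> fL; pose m := GRing.isLinear.Build F U V *:%R f fL.
by exists (HB.pack_for {linear U -> V} f m).
Qed.

Lemma linear_inverse (U V : lmodType F) (f : {linear U -> V}) :
  bijective f -> exists g : {linear V -> U}, cancel f g /\ cancel g f.
Proof.
move=> [g fK gK]; have [h hE] := linear_packing (can2_linear fK gK).
by exists h; split=> x; rewrite hE.
Qed.

(** [{malg F[I]}] is the free vector space on [I], with basis vectors [<< i >>], and [lin e] is the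
    linear extension of [e]. *)
Definition lin (I : choiceType) (V : lmodType F) (e : I -> V) (m : {malg F[I]}) : V :=
  \sum_(i <- msupp m) m@_i *: e i.

Section Lin.
Variables (I : choiceType) (V : lmodType F).
Implicit Types (e : I -> V) (m : {malg F[I]}).

Lemma linEw e (d : {fset I}) m : (msupp m `<=` d)%fset ->
  lin e m = \sum_(i <- d) m@_i *: e i.
Proof.
move=> md; rewrite /lin -(big_fset_incl _ md) //.
by move=> i _ /mcoeff_outdom ->; rewrite scale0r.
Qed.

Lemma lin_is_linear e : linear (lin e).
Proof.
move=> c m1 m2; pose d := (msupp m1 `|` msupp m2 `|` msupp (c *: m1 + m2))%fset.
rewrite !(@linEw e d); first last.
- by rewrite /d fsubsetUr.
- by rewrite /d -fsetUA fsubsetUl.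
- by rewrite /d fsetUAC fsubsetUr.
rewrite scaler_sumr -big_split /=; apply: eq_bigr => i _.
by rewrite mcoeffD mcoeffZ scalerDl scalerA.
Qed.

HB.instance Definition _ e :=
  GRing.isLinear.Build F {malg F[I]} V *:%R (lin e) (lin_is_linear e).

Lemma linU e i : lin e << i >> = e i.
Proof. by rewrite /lin msuppU oner_eq0 big_seq_fset1 mcoeffUU scale1r. Qed.

Lemma malg_expand m : m = \sum_(i <- msupp m) m@_i *: << i >>.
Proof.
rewrite {1}(monalgE m); apply: eq_bigr => i _; apply/malgP => k.
by rewrite mcoeffZ !mcoeffU mulr_natr.
Qed.

Lemma eq_malg_linear (f g : {linear {malg F[I]} -> V}) :
  (forall i, f << i >> = g << i >>) -> f =1 g.
Proof.
move=> fg m; rewrite (malg_expand m) !linear_sum; apply: eq_bigr => i _.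
by rewrite !linearZ fg.
Qed.

End Lin.

Lemma lin_bijective (I K : choiceType) (s : I -> K) : bijective s ->
  bijective (lin (fun i => << s i >> : {malg F[K]})).
Proof.
move=> [t sK tK]; exists (lin (fun k => << t k >>)) => m.
  rewrite -[RHS]/(idfun m) -[LHS]/((_ \o _) m).
  by apply: eq_malg_linear => i /=; rewrite !linU sK.
rewrite -[RHS]/(idfun m) -[LHS]/((_ \o _) m).
by apply: eq_malg_linear => i /=; rewrite !linU tK.
Qed.

Lemma lin_mcoeff (I K : choiceType) (s : I -> K) (m : {malg F[I]}) i :
  injective s -> (lin (fun i => << s i >> : {malg F[K]}) m)@_(s i) = m@_i.
Proof.
move=> sI; pose d := (i |` msupp m)%fset.
rewrite (@linEw _ _ _ d) ?fsubsetUr // raddf_sum /= (bigD1_seq i) ?fset_uniq //=; last first.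
  by rewrite !inE eqxx.
rewrite mcoeffZ mcoeffUU mulr1 big1 ?addr0 // => j ji.
by rewrite mcoeffZ mcoeffU (inj_eq sI) (negbTE ji) mulr0.
Qed.

Lemma malg_sum_bijection (I K : choiceType) :
  exists f : {linear ({malg F[I]} * {malg F[K]})%type -> {malg F[(I + K)%type]}},
    bijective f.
Proof.
pose a : {linear {malg F[I]} -> {malg F[(I + K)%type]}} :=
  lin (fun i => << inl i >>).
pose b : {linear {malg F[K]} -> {malg F[(I + K)%type]}} :=
  lin (fun k => << inr k >>).
pose c (x : I + K) : ({malg F[I]} * {malg F[K]})%type :=
  match x with inl i => (<< i >>, 0) | inr k => (0, << k >>) end.
have [f fE] : exists f : {linear ({malg F[I]} * {malg F[K]})%type -> {malg F[(I + K)%type]}},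
    forall x, f x = a x.1 + b x.2.
  apply: linear_packing => k [x1 x2] [y1 y2].
  rewrite -[k *: _ + _]/(k *: x1 + y1, k *: x2 + y2) /=.
  by rewrite !linearP scalerDr addrACA.
have ca x : lin c (a x) = (x, 0).
  have [g gE] : exists g : {linear {malg F[I]} -> ({malg F[I]} * {malg F[K]})%type},
      g =1 (fun x => (x, 0)).
    by apply: linear_packing => k u v; congr pair; rewrite /= scaler0 addr0.
  rewrite -gE -[LHS]/((lin c \o a) x); apply: eq_malg_linear => i.
  by rewrite gE /= !linU.
have cb y : lin c (b y) = (0, y).
  have [g gE] : exists g : {linear {malg F[K]} -> ({malg F[I]} * {malg F[K]})%type},
      g =1 (fun x => (0, x)).
    by apply: linear_packing => k u v; congr pair; rewrite /= scaler0 addr0.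
  rewrite -gE -[LHS]/((lin c \o b) y); apply: eq_malg_linear => i.
  by rewrite gE /= !linU.
exists f; exists (lin c) => [[x y]|m].
  transitivity (lin c (a x) + lin c (b y)); first by rewrite fE linearD.
  by rewrite ca cb; congr pair; rewrite /= ?addr0 ?add0r.
rewrite -[RHS]/(idfun m) -[LHS]/((f \o lin c) m); apply: eq_malg_linear => -[i|k].
  by rewrite /= linU fE /= linU linear0 addr0.
by rewrite /= linU fE /= linU linear0 add0r.
Qed.

End FreeModule.

(** * Differences of similar endomorphisms *)

Lemma seq_max (T : choiceType) (lt : T -> T -> Prop) (s : seq T) :
  (forall x y z, lt x y -> lt y z -> lt x z) ->
  (forall x y, [\/ lt x y, x = y | lt y x]) -> s != [::] ->
  exists2 x, x \in s & forall y, y \in s -> y = x \/ lt y x.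
Proof.
move=> tr tot; elim: s => // a [_ _|b s /(_ isT) [x xs xmax] _].
  by exists a; rewrite ?mem_head // => y; rewrite inE => /eqP ->; left.
case: (tot a x) => h.
- by exists x; [rewrite inE xs orbT|move=> y; rewrite inE => /orP[/eqP->|/xmax//]; right].
- by exists x; [rewrite inE xs orbT|move=> y; rewrite inE => /orP[/eqP->|/xmax//]; left].
- exists a; first exact: mem_head.
  move=> y; rewrite inE => /orP[/eqP->|/xmax [->|yx]]; first by left.
    by right.
  by right; exact: tr yx h.
Qed.

(** * Unitriangular maps over a well-ordered basis *)

Section Unitriangular.
Variables (F : fieldType) (X : choiceType) (lt : X -> X -> Prop).
Hypothesis lt_wf : well_founded lt.
Hypothesis lt_tr : forall x y z, lt x y -> lt y z -> lt x z.
Hypothesis lt_tot : forall x y, [\/ lt x y, x = y | lt y x].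
Local Notation M := {malg F[X]}.

Lemma wf_irr x : ~ lt x x.
Proof. by elim/(well_founded_ind lt_wf): x => x IH xx; exact: (IH x xx xx). Qed.

Definition low (x : X) (m : M) := forall y, y \in msupp m -> lt y x.

Lemma low0 x : low x 0.
Proof. by move=> y; rewrite msupp0. Qed.

Lemma lowD x m1 m2 : low x m1 -> low x m2 -> low x (m1 + m2).
Proof.
move=> h1 h2 y /(fsubsetP (msuppD_le m1 m2)); rewrite inE.
by move=> /orP[/h1|/h2].
Qed.

Lemma lowZ x c m : low x m -> low x (c *: m).
Proof. by move=> h y /(fsubsetP (msuppZ_le c m)) /h. Qed.

Lemma lowB x m1 m2 : low x m1 -> low x m2 -> low x (m1 - m2).
Proof. by move=> h1 h2; rewrite -scaleN1r; apply: lowD => //; exact: lowZ. Qed.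

Lemma low_linear (f : {linear M -> M}) x z m :
  low x m -> (forall y, lt y x -> low z (f << y >>)) -> low z (f m).
Proof.
move=> mx h; rewrite [m]malg_expand linear_sum big_seq.
apply: (big_ind (low z)) => [|m1 m2|y ym]; first exact: low0.
  exact: lowD.
by rewrite linearZ; apply/lowZ/h/mx.
Qed.

(** Injectivity: at the largest index of [m], the coefficient of [lin Phi m] is that of [m].
    Surjectivity: by well-founded induction, [<< x >>] is [Phi x] minus lower terms already
    reached. *)
Lemma unitriangular_bijective (Phi : X -> M) :
  (forall x, low x (Phi x - << x >>)) -> bijective (lin Phi).
Proof.
move=> tri; apply: bijectiveT.
  suff inj0 (m : M) : lin Phi m = 0 -> m = 0 by apply: raddf_inj; exact: inj0.
  move=> m0; apply/eqP; apply: contraT => mn0.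
  have ms : msupp m != fset0.
    apply: contra mn0 => /eqP e; apply/eqP/malgP => k.
    by rewrite mcoeff0 mcoeff_outdom // e inE.
  have [|x xm xmax] := seq_max (s := msupp m) lt_tr lt_tot.
    apply: contra ms => /eqP e; apply/eqP/fsetP => y.
    by rewrite -[y \in msupp m]/(y \in enum_fset _) e.
  have : (lin Phi m)@_x = 0 by rewrite m0 mcoeff0.
  rewrite /lin raddf_sum /= (bigD1_seq x) //= big_seq_cond big1.
    have -> : Phi x = << x >> + (Phi x - << x >>) by rewrite addrC subrK.
    rewrite addr0 mcoeffZ mcoeffD mcoeffUU [X in _ + X]mcoeff_outdom.
      by rewrite addr0 mulr1 => /eqP; rewrite mcoeff_eq0 xm.
    by apply/negP => /tri /wf_irr.
  move=> y /andP[ym yx]; rewrite mcoeffZ.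
  have -> : Phi y = << y >> + (Phi y - << y >>) by rewrite addrC subrK.
  rewrite mcoeffD mcoeffU (negbTE yx) mulr0n add0r [X in _ * X]mcoeff_outdom ?mulr0 //.
  apply/negP => /tri xy; case: (xmax y ym) => [e|/(lt_tr xy)/wf_irr//].
  by rewrite e eqxx in yx.
have cl0 : exists m, lin Phi m = 0 by exists 0; rewrite linear0.
have clL (s : seq X) (c : X -> F) : (forall x, x \in s -> exists m, lin Phi m = << x >>) ->
    exists m, lin Phi m = \sum_(x <- s) c x *: << x >>.
  elim: s => [_|x s IH h]; first by rewrite big_nil.
  have [m me] := h x (mem_head _ _).
  have [|m' me'] := IH; first by move=> y ys; apply: h; rewrite inE ys orbT.
  by exists (c x *: m + m'); rewrite big_cons -me -me' linearP.
have clU x : exists m, lin Phi m = << x >>.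
  elim/(well_founded_ind lt_wf): x => x IH.
  have [|m me] := @clL (msupp (Phi x - << x >>)) (fun y => (Phi x - << x >>)@_y).
    by move=> y /tri /IH.
  exists (<< x >> - m); rewrite linearB [X in _ - X]me [X in X - _]linU -malg_expand.
  by rewrite opprB addrC subrK.
by move=> m; rewrite [m]malg_expand; apply: clL.
Qed.

(* [f] moves every basis vector above everything [B] can produce from it, so
   that [T : x |-> f x] and [T - B] have the same leading terms and both act
   freely on the generators outside the image of [f]. *)
Lemma dominated_shift_similar (B : {linear M -> M}) (f : X -> X) :
  (forall x, lt x (f x)) -> (forall x y, lt x y -> lt (f x) (f y)) ->
  (forall x, low (f x) (B << x >>)) ->
  exists T g : {linear M -> M}, bijective g /\
    forall m, g (T m) = T (g m) - B (g m).
Proof.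
move=> f1 f2 fB.
have fI : injective f.
  by move=> x y e; case: (lt_tot x y) => // /f2; rewrite e => /wf_irr.
(* Going down along [f] stops by well-foundedness, so each [x] is [f^k z] with [z] outside the image
   of [f]; [decU] gives uniqueness. *)
have dec x : exists p : nat * X, x = iter p.1 f p.2 /\ forall y, f y <> p.2.
  elim/(well_founded_ind lt_wf): x => x IH.
  have [[y yx]|/forallNP nx] := pselect (exists y, f y = x); last by exists (0%N, x).
  have [|[k z] [/= yz zP]] := IH y; first by rewrite -yx.
  by exists (k.+1, z); split=> //=; rewrite -yz.
have decU k l x y : (forall z, f z <> x) -> (forall z, f z <> y) ->
    iter k f x = iter l f y -> k = l /\ x = y.
  move=> nx ny; elim: k l => [|k IH] [|l] //=.
  - by move=> e; case: (nx (iter l f y)).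
  - by move=> e; case: (ny (iter k f x)).
  - by move=> /fI /IH [-> ->].
have [p pP] := choice dec.
pose T : {linear M -> M} := lin (fun x => << f x >> : M).
have TU x : T << x >> = << f x >> by exact: linU.
have [C CE] : exists C : {linear M -> M}, forall m, C m = T m - B m.
  by apply: linear_packing => c u v; rewrite (linearP T) (linearP B) scalerBr opprD addrACA.
(* For [x = f^k z] this is [C^k << z >>] with [C = T - B]; hence [lin Phi] intertwines [T] and
   [C]. *)
pose Phi x := iter (p x).1 C << (p x).2 >>.
have PhiC x : Phi (f x) = C (Phi x).
  have [e1 n1] := pP x; have [e2 n2] := pP (f x).
  have [|||k z] := @decU (p (f x)).1 (p x).1.+1 (p (f x)).2 (p x).2 => //.
    by rewrite -e2 /= -e1.
  by rewrite /Phi k z.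
exists T, (lin Phi); split; last first.
  move=> m; rewrite -[T _ - _]CE -[LHS]/((lin Phi \o T) m) -[RHS]/((C \o lin Phi) m).
  by apply: eq_malg_linear => x; rewrite /= !linU.
apply: unitriangular_bijective => x; rewrite /Phi.
case: (p x) (pP x) => k z [-> _] /=.
elim: k => [|k IH] /=; first by rewrite subrr; exact: low0.
set y := iter k f _ in IH *; set m := iter k C _ in IH *.
(* The new error is [C] applied to the old one, minus [B << y >>]. Both terms lie strictly below
   [f y], as [f] is increasing and dominates [B]. *)
have -> : C m - << f y >> = C (m - << y >>) - B << y >>.
  by rewrite linearB (CE << y >>) TU opprB addrA addrAC addrK.
apply: lowB; last exact: fB.
apply: low_linear IH _ => w wy; rewrite CE TU.
apply: lowB; last by move=> t /fB tz; exact: lt_tr tz (f2 _ _ wy).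
by move=> t; rewrite msuppU oner_eq0 inE => /eqP ->; exact: f2.
Qed.

End Unitriangular.

(** Stratification reindexes the basis by [J * nat], ordered lexicographically, so that [B] never
    raises the first coordinate. A shift that only increases the second coordinate can then dominate
    [B]. *)
Lemma difference_of_similar (F : fieldType) (I : choiceType)
    (B : {linear {malg F[I]} -> {malg F[I]}}) : embeds nat I ->
  exists T g : {linear {malg F[I]} -> {malg F[I]}}, bijective g /\
    forall m, g (T m) = T (g m) - B (g m).
Proof.
move=> inf; have [J [lt [th [thb wf tr tot sB]]]] :=
  stratification (fun i => msupp (B << i >>)) inf.
pose ltp (x y : J * nat) := lt x.1 y.1 \/ (x.1 = y.1 /\ (x.2 < y.2)%N).
have [a [aK a'K]] := linear_inverse (lin_bijective F thb).
pose t : {linear {malg F[(J * nat)%type]} -> {malg F[I]}} :=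
  lin (fun i => << th i >> : {malg F[I]}).
pose B' : {linear {malg F[(J * nat)%type]} -> {malg F[(J * nat)%type]}} := a \o B \o t.
pose bd x := \max_(y <- msupp (B' << x >>)) y.2.
(* Summing the bounds [bd] over all positions up to [x.2], instead of taking the last one alone,
   makes [f] increasing within each block. *)
pose f (x : J * nat) := (x.1, x.2.+1 + \sum_(i < x.2.+1) bd (x.1, nat_of_ord i))%N.
have sB' x y : y \in msupp (B' << x >>) -> lt y.1 x.1 \/ y.1 = x.1.
  move=> yx; apply: sB; move: yx; rewrite /B' /= linU.
  rewrite -!mcoeff_neq0; apply: contra_neq => e.
  by rewrite -(lin_mcoeff _ _ (bij_inj thb)) a'K.
have [||||||T [g [gb gT]]] := @dominated_shift_similar F _ ltp _ _ _ B' f.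
- move=> [j n]; elim/(well_founded_ind wf): j n => j IH n.
  elim/ltn_ind: n => n IHn; constructor => -[i m] [/IH//|[/= -> /IHn]]; exact.
- move=> [i k] [j l] [h n] [/= ij|[/= -> kl]] [/= jh|[/= <- ln]].
  + by left; exact: tr ij jh.
  + by left.
  + by left.
  + by right; split=> //; exact: ltn_trans kl ln.
- move=> [i k] [j l]; case: (tot i j) => [ij|<-|ji].
  + by constructor 1; left.
  + case: (ltngtP k l) => [kl|lk|->]; last by constructor 2.
    * by constructor 1; right.
    * by constructor 3; right.
  + by constructor 3; left.
- by move=> [j n]; right; split=> //=; rewrite ltnS leq_addr.
- move=> [i k] [j l] [/= ij|[/= <- kl]]; first by left.
  right; split=> //=; rewrite -addSn leq_add //.
  rewrite -!(big_mkord xpredT (fun n => bd (i, n))).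
  by rewrite (@big_cat_nat _ _ _ k.+1 0 l.+1) ?leq_addr // ltnS ltnW.
- move=> [j n] [i m] /[dup] /sB' /= [ij|->] ym; first by left.
  right; split=> //=; rewrite addSn ltnS; apply: leq_trans (leq_addl _ _).
  rewrite big_ord_recr /=; apply: leq_trans (leq_addl _ _).
  exact: (@leq_bigmax_seq _ _ xpredT (fun y : J * nat => y.2) (j, m) ym isT).
pose T1 : {linear {malg F[I]} -> {malg F[I]}} := t \o T \o a.
pose g1 : {linear {malg F[I]} -> {malg F[I]}} := t \o g \o a.
exists T1, g1; split.
  apply: bij_comp; last by exists t.
  by apply: bij_comp => //; exact: lin_bijective.
by move=> m; rewrite /= !aK gT linearB /B' /= a'K.
Qed.

(** * Sums of three quadratic endomorphisms *)

Section ModuleIdentities.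
Variables (R : comRingType) (V : lmodType R).

Inductive mexp :=
| MVar of nat | MZero | MAdd of mexp & mexp | MOpp of mexp | MScale of R & mexp.

Fixpoint meval (env : seq V) e : V :=
  match e with
  | MVar n => env`_n
  | MZero => 0
  | MAdd a b => meval env a + meval env b
  | MOpp a => - meval env a
  | MScale c a => c *: meval env a
  end.

Fixpoint mcoef e (n : nat) : R :=
  match e with
  | MVar k => if Nat.eqb k n then 1 else 0
  | MZero => 0
  | MAdd a b => mcoef a n + mcoef b n
  | MOpp a => - mcoef a n
  | MScale c a => c * mcoef a n
  end.

Fixpoint same_coefs (n : nat) e1 e2 : Prop :=
  if n is k.+1 then mcoef e1 k = mcoef e2 k /\ same_coefs k e1 e2 else True.

Lemma mevalE env e : meval env e = \sum_(i < size env) mcoef e i *: env`_i.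
Proof.
elim: e => [n||a IHa b IHb|a IHa|c a IHa] /=.
- have eqbE k : Nat.eqb n k = (k == n).
    by apply/idP/eqP => [/PeanoNat.Nat.eqb_eq|->]; rewrite ?PeanoNat.Nat.eqb_refl.
  have [ns|ns] := ltnP n (size env).
    rewrite (bigD1 (Ordinal ns)) //= eqbE eqxx scale1r big1 ?addr0 // => i ni.
    by rewrite eqbE (negbTE (ni : (i != n :> nat))) scale0r.
  rewrite nth_default // big1 // => i _; rewrite eqbE ltn_eqF ?scale0r //.
  exact: leq_trans (ltn_ord i) ns.
- by rewrite big1 // => i _; rewrite scale0r.
- by rewrite IHa IHb -big_split; apply: eq_bigr => i _; rewrite scalerDl.
- by rewrite IHa -sumrN; apply: eq_bigr => i _; rewrite scaleNr.
- by rewrite IHa scaler_sumr; apply: eq_bigr => i _; rewrite scalerA.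
Qed.

(** Both sides are combinations of the same atoms, so it is enough to compare coefficients;
    [same_coefs] unfolds to finitely many scalar equations, left to [ring]. *)
Lemma meval_eq env e1 e2 : same_coefs (size env) e1 e2 -> meval env e1 = meval env e2.
Proof.
move=> h; rewrite !mevalE; apply: eq_bigr => i _; congr (_ *: _).
elim: (size env) i h => [|n IH] [k kn] //= [en /IH h].
move: kn; rewrite ltnS leq_eqVlt => /orP[/eqP -> //|kn].
exact: (h (Ordinal kn)).
Qed.

End ModuleIdentities.

(** Atoms are compared by [unify], hence up to conversion; the nested [match constr:(tt)] runs this
    tactic while a term is being built. *)
Ltac module_insert t env :=
  lazymatch env with
  | nil => constr:(cons t nil)
  | cons ?x ?r =>
    match constr:(tt) with
    | _ => let _ := match constr:(tt) with _ => unify x t end in env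
    | _ => let r' := module_insert t r in constr:(cons x r')
    end
  end.

Ltac module_atoms env t :=
  lazymatch t with
  | Algebra.add ?a ?b => let env' := module_atoms env a in module_atoms env' b
  | Algebra.opp ?a => module_atoms env a
  | Algebra.zero => env
  | GRing.scale _ ?a => module_atoms env a
  | _ => module_insert t env
  end.

Ltac module_index t env :=
  lazymatch env with
  | cons ?x ?r =>
    match constr:(tt) with
    | _ => let _ := match constr:(tt) with _ => unify x t end in constr:(O)
    | _ => let n := module_index t r in constr:(S n)
    end
  end.

Ltac module_reify R env t :=
  lazymatch t with
  | Algebra.add ?a ?b =>
    let a' := module_reify R env a in let b' := module_reify R env b in
    constr:(@MAdd R a' b')
  | Algebra.opp ?a => let a' := module_reify R env a in constr:(@MOpp R a')
  | Algebra.zero => constr:(@MZero R)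
  | GRing.scale ?c ?a => let a' := module_reify R env a in constr:(@MScale R c a')
  | _ => let n := module_index t env in constr:(@MVar R n)
  end.

Ltac module R V :=
  rewrite /=;
  match goal with |- @eq _ ?l ?r =>
    let env0 := module_atoms (@nil (GRing.Lmodule.sort V)) l in
    let env := module_atoms env0 r in
    let l' := module_reify R env l in
    let r' := module_reify R env r in
    change (@meval R V env l' = @meval R V env r');
    apply: meval_eq; rewrite /=; repeat split; ring
  end.

(** * Quadratic endomorphisms and their block forms *)

Section QuadraticSums.
Variables (F : fieldType) (a1 b1 a2 b2 a3 b3 : F).

(** This is [(f - a)(f - b) = 0], expanded. *)
Definition quadratic (V : lmodType F) (a b : F) (f : V -> V) :=
  forall v, f (f v) = (a + b) *: f v - (a * b) *: v.

Definition qsum3 (V : lmodType F) (u : V -> V) :=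
  exists u1 u2 u3 : {linear V -> V},
    [/\ forall v, u v = u1 v + u2 v + u3 v, quadratic a1 b1 u1,
        quadratic a2 b2 u2 & quadratic a3 b3 u3].

Lemma quadratic_conj (U V : lmodType F) (f : {linear U -> V}) (g : {linear V -> U})
    a b (u : U -> U) :
  cancel f g -> quadratic a b u -> cancel g f -> quadratic a b (fun v => f (u (g v))).
Proof. by move=> fK uq gK v; rewrite fK uq linearB !linearZ gK. Qed.

Lemma qsum3_iso (U V : lmodType F) (f : {linear U -> V}) (u : U -> U) (w : V -> V) :
  bijective f -> (forall x, f (u x) = w (f x)) -> qsum3 u -> qsum3 w.
Proof.
move=> /linear_inverse[g [fK gK]] uw [u1 [u2 [u3 [uE q1 q2 q3]]]].
exists (f \o u1 \o g), (f \o u2 \o g), (f \o u3 \o g); split.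
- by move=> v; rewrite /= -!linearD -uE uw gK.
- exact: quadratic_conj fK q1 gK.
- exact: quadratic_conj fK q2 gK.
- exact: quadratic_conj fK q3 gK.
Qed.

Definition prod_map (U V : Type) (f : U -> U) (g : V -> V) (z : U * V) : U * V :=
  (f z.1, g z.2).

Lemma prod_map_linear (U V : lmodType F) (f : {linear U -> U}) (g : {linear V -> V}) :
  linear (prod_map f g).
Proof. by move=> c x y; congr pair; rewrite /= linearP. Qed.

Lemma qsum3_prod (U V : lmodType F) (u : U -> U) (v : V -> V) :
  qsum3 u -> qsum3 v -> qsum3 (prod_map u v).
Proof.
move=> [u1 [u2 [u3 [uE p1 p2 p3]]]] [v1 [v2 [v3 [vE q1 q2 q3]]]].
have [w1 e1] := linear_packing (prod_map_linear u1 v1).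
have [w2 e2] := linear_packing (prod_map_linear u2 v2).
have [w3 e3] := linear_packing (prod_map_linear u3 v3).
exists w1, w2, w3; split=> z; rewrite ?e1 ?e2 ?e3 //.
- by congr pair; rewrite /= ?uE ?vE.
- by congr pair; rewrite /= ?p1 ?q1.
- by congr pair; rewrite /= ?p2 ?q2.
- by congr pair; rewrite /= ?p3 ?q3.
Qed.

Lemma quadratic_scalar (V : lmodType F) a b x : (x == a) || (x == b) ->
  quadratic a b (fun v : V => x *: v).
Proof.
move=> xab v; rewrite !scalerA -scalerBl; congr (_ *: _).
case/orP: xab => /eqP ->; rewrite mulrDl; first by rewrite [b * a]mulrC addrK.
by rewrite addrAC subrr add0r.
Qed.

Lemma qsum3_scalar (V : lmodType F) x1 x2 x3 :
  (x1 == a1) || (x1 == b1) -> (x2 == a2) || (x2 == b2) ->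
  (x3 == a3) || (x3 == b3) -> qsum3 (fun v : V => (x1 + x2 + x3) *: v).
Proof.
have sc x : exists f : {linear V -> V}, f =1 (fun v => x *: v).
  by apply: linear_packing => c u v; rewrite scalerDr !scalerA mulrC.
move=> h1 h2 h3; have [f1 e1] := sc x1; have [f2 e2] := sc x2; have [f3 e3] := sc x3.
exists f1, f2, f3; split=> v; rewrite ?e1 ?e2 ?e3.
- by rewrite !scalerDl.
- exact: quadratic_scalar.
- exact: quadratic_scalar.
- exact: quadratic_scalar.
Qed.

Lemma quadratic_upper (U : lmodType F) a b (f : {linear U -> U}) :
  quadratic a b (fun z : U * U => (a *: z.1 + f z.2, b *: z.2)).
Proof.
move=> [x y]; congr pair => /=.
  by rewrite linearZ; module F U.
by rewrite !scalerA -scalerBl mulrDl addrAC subrr add0r.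
Qed.

Lemma quadratic_lower (U : lmodType F) a b (f : {linear U -> U}) :
  quadratic a b (fun z : U * U => (a *: z.1, f z.1 + b *: z.2)).
Proof.
move=> [x y]; congr pair => /=.
  by rewrite !scalerA -scalerBl mulrDl [b * a]mulrC addrK.
by rewrite linearZ; module F U.
Qed.

(* The companion matrix of (t - a) (t - b), written in the coordinates
   (x, t) with t = P x + h y. *)
Lemma quadratic_companion (U : lmodType F) a b (P g h : {linear U -> U}) :
  cancel g h -> cancel h g ->
  quadratic a b (fun z : U * U => let t := P z.1 + h z.2 in
     (t, g ((a + b) *: t - (a * b) *: z.1 - P t))).
Proof.
move=> gK hK [x y] /=; set t := P x + h y; set t' := P t + _.
have -> : t' = (a + b) *: t - (a * b) *: x by rewrite /t' gK addrC subrK.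
congr pair; rewrite /=.
have ey : y = g (t - P x) by rewrite /t addrAC subrr add0r hK.
rewrite [in RHS]ey !(linearB, linearD, linearZ) /= !(linearB, linearD, linearZ).
module F U.
Qed.

(** The companion map of [quadratic_companion] has diagonal blocks [P] and [a1 + b1 - g P h], where
    [h] is the inverse of [g], and upper right block [h]. The upper left block forces
    [P = al - (a2 + a3)]; the triangular summands correct the off-diagonal blocks through [f] and
    [N]; the lower right block then agrees exactly by the hypothesis on [g]. *)
Lemma qsum3_block (U : lmodType F) (al be ga de g : {linear U -> U}) :
  bijective g ->
  (forall x, g (al x) + de (g x) = (a1 + b1 + a2 + b2 + a3 + b3) *: g x) ->
  qsum3 (fun z : U * U => (al z.1 + be z.2, ga z.1 + de z.2)).
Proof.
move=> /linear_inverse[h [gK hK]] gal.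
have [P PE] : exists P : {linear U -> U}, forall x, P x = al x - (a2 + a3) *: x.
  by apply: linear_packing => c x y; rewrite linearP; module F U.
have [f fE] : exists f : {linear U -> U}, forall y, f y = be y - h y.
  by apply: linear_packing => c x y; rewrite !linearP; module F U.
have [N NE] : exists N : {linear U -> U},
    forall x, N x = ga x - g ((a1 + b1) *: P x - (a1 * b1) *: x - P (P x)).
  apply: linear_packing => c x y.
  rewrite !(linearP, linearB, linearZ, linearD) /= !(linearP, linearB, linearZ, linearD).
  by module F U.
have [|u1 u1E] := linear_packing (f := fun z : U * U => let t := P z.1 + h z.2 in
    (t, g ((a1 + b1) *: t - (a1 * b1) *: z.1 - P t))).
  move=> c [x y] [x' y'] /=; congr pair; rewrite /= !(linearB, linearD, linearZ) /=.
    by module F U.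
  by rewrite !(linearB, linearD, linearZ) /= !(linearB, linearD, linearZ); module F U.
have [|u2 u2E] := linear_packing (f := fun z : U * U => (a2 *: z.1 + f z.2, b2 *: z.2)).
  by move=> c [x y] [x' y']; congr pair; rewrite /= ?linearP; module F U.
have [|u3 u3E] := linear_packing (f := fun z : U * U => (a3 *: z.1, N z.1 + b3 *: z.2)).
  by move=> c [x y] [x' y']; congr pair; rewrite /= ?linearP; module F U.
have qE (a b : F) (u v : U * U -> U * U) : u =1 v -> quadratic a b v -> quadratic a b u.
  by move=> uv q z; rewrite !uv q.
exists u1, u2, u3; split.
- move=> [x y]; rewrite u1E u2E u3E /=; congr pair; rewrite /=.
    by rewrite PE fE; module F U.
  have -> : de y = (a1 + b1 + a2 + b2 + a3 + b3) *: y - g (al (h y)).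
    by have := gal (h y); rewrite hK => <-; rewrite addrAC subrr add0r.
  rewrite NE !(linearB, linearD, linearZ) /= !(linearB, linearD, linearZ) /=.
  rewrite (PE (h y)) linearB linearZ /= hK; module F U.
- by apply: qE u1E _; exact: quadratic_companion.
- by apply: qE u2E _; exact: quadratic_upper.
- by apply: qE u3E _; exact: quadratic_lower.
Qed.

End QuadraticSums.

(** * Bases and ranks *)

(** A subset made into a choice type, so that it can index a free module. *)
Definition of_pred (V : choiceType) (A : V -> Prop) : choiceType := {x : V | `[< A x >]}.

Lemma of_predP (V : choiceType) (A : V -> Prop) (x : of_pred A) : A (sval x).
Proof. exact/asboolP/(svalP x). Qed.

Section Bases.
Variables (F : fieldType) (V : lmodType F).

Lemma lin_sval (A : V -> Prop) (m : {malg F[of_pred A]}) :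
  exists (s : seq V) (c : V -> F), [/\ uniq s, forall x, x \in s -> A x,
    lin sval m = \sum_(x <- s) c x *: x &
    (forall x, x \in s -> c x = 0) -> m = 0].
Proof.
exists [seq sval i | i <- msupp m].
(* [insub] recovers the index from the vector; the coefficient is 0 outside [A]. *)
exists (fun x => odflt 0 (omap (fun i : of_pred A => m@_i) (insub x))).
have insubE (i : of_pred A) : insub (sval i) = Some i by exact: valK.
split.
- by rewrite map_inj_uniq ?fset_uniq //; exact: val_inj.
- by move=> _ /mapP[i _ ->]; exact: of_predP.
- by rewrite big_map; apply: eq_bigr => i _; rewrite insubE.
- move=> h; apply/malgP => i; rewrite mcoeff0.
  have [im|/mcoeff_outdom//] := boolP (i \in msupp m).
  by have := h _ (map_f sval im); rewrite insubE.
Qed.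

Lemma sum_lin_sval (A : V -> Prop) (s : seq V) (c : V -> F) :
  (forall x, x \in s -> A x) ->
  exists m : {malg F[of_pred A]}, lin sval m = \sum_(x <- s) c x *: x.
Proof.
elim: s => [_|x s IH h]; first by exists 0; rewrite linear0 big_nil.
have [|m me] := IH; first by move=> y ys; apply: h; rewrite inE ys orbT.
have Ax : `[< A x >] by apply/asboolP/h/mem_head.
exists (c x *: << exist _ x Ax : of_pred A >> + m).
by rewrite linearP big_cons -me; congr (_ *: _ + _); exact: linU.
Qed.

Lemma basis_of_lin (W A : V -> Prop) : basis_of W A ->
  injective (lin (sval : of_pred A -> V)) /\
  forall v, W v -> exists m : {malg F[of_pred A]}, lin sval m = v.
Proof.
move=> [AW Aind Wspan]; split; last first.
  by move=> v /Wspan[s [c [sA ->]]]; exact: sum_lin_sval.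
apply: raddf_inj => m m0; have [s [c [us sA e]]] := lin_sval m; apply.
by apply: Aind => //; rewrite -e.
Qed.

(** If [l] were longer than [s], the matrix of [l] in terms of [s] would have more rows than
    columns, and a nonzero row vector in its left kernel would be a relation on [l]. *)
Lemma indep_size_le (s l : seq V) : uniq l -> lin_indep (fun x => x \in l) ->
  (forall x, x \in l -> exists c : V -> F, x = \sum_(y <- s) c y *: y) ->
  (size l <= size s)%N.
Proof.
move=> ul lind /= lspan; rewrite leqNgt; apply/negP => lt.
have /choice[c cP] (i : 'I_(size l)) : exists c : V -> F, l`_i = \sum_(y <- s) c y *: y.
  by apply: lspan; rewrite mem_nth.
pose C := \matrix_(i < size l, j < size s) c i s`_j.
have : kermx C != 0.
  rewrite kermx_eq0 /row_free; apply: contraTneq lt => <-.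
  by rewrite -leqNgt rank_leq_col.
move=> /rowV0Pn[r /sub_kermxP rC r0].
pose d x := if insub (index x l) is Some i then r 0 i else 0.
have dE (i : 'I_(size l)) : d l`_i = r 0 i.
  by rewrite /d index_uniq // valK.
case/eqP: r0; apply/rowP => i; rewrite mxE -dE.
apply: (lind l) => //; last exact: mem_nth.
rewrite (big_nth 0) big_mkord.
transitivity (\sum_(i < size l) \sum_(j < size s) (r 0 i * C i j) *: s`_j).
  apply: eq_bigr => k _; rewrite dE cP (big_nth 0) big_mkord scaler_sumr.
  by apply: eq_bigr => j _; rewrite scalerA mxE.
rewrite exchange_big big1 //= => j _; rewrite -scaler_suml.
by have /matrixP/(_ 0 j) := rC; rewrite !mxE => ->; rewrite scale0r.
Qed.

Lemma sum_over_uniq (r t : seq V) (c : V -> F) : uniq t -> (forall y, y \in r -> y \in t) ->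
  exists c' : V -> F, \sum_(y <- r) c y *: y = \sum_(y <- t) c' y *: y.
Proof.
move=> ut; elim: r => [_|x r IH h].
  by exists (fun _ => 0); rewrite big_nil big1 // => y _; rewrite scale0r.
have [|c' ce] := IH; first by move=> y yr; apply: h; rewrite inE yr orbT.
exists (fun y => (if y == x then c x else 0) + c' y).
under [RHS]eq_bigr do rewrite scalerDl.
rewrite big_cons ce big_split /=; congr (_ + _).
rewrite (bigD1_seq x) ?h ?mem_head //= eqxx big1 ?addr0 // => y /negbTE ->.
by rewrite scale0r.
Qed.

(** If a finite list contained [A], its size would bound every independent family in [W]. *)
Lemma basis_of_infinite (W A : V -> Prop) : basis_of W A -> infinite_dim W ->
  embeds nat (of_pred A).
Proof.
move=> [AW Aind Wspan] Winf.
have [|g gI gA] := @nat_embeds_sub V A.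
  move=> s; apply: contrapT => /forall2NP ns.
  have [l [sl ul lW lind]] := Winf (size s).+1.
  have : (size l <= size s)%N; last by rewrite sl ltnn.
  have [t [ts tuniq]] : exists t : seq V, t =i s /\ uniq t.
    by exists (undup s); split; [exact: mem_undup|exact: undup_uniq].
  apply: leq_trans (_ : (size t <= _)%N); last first.
    by apply: uniq_leq_size => // x; rewrite ts.
  apply: indep_size_le => // x /lW /Wspan [r [c [rA ->]]].
  have rs y : y \in r -> y \in t.
    move=> /rA Ay; have := ns y; case=> // /negP; rewrite ts.
    by rewrite negbK.
  by have [c' ->] := sum_over_uniq c tuniq rs; exists c'.
exists (fun n => exist _ (g n) (introT (asboolP _) (gA n))) => m n [].
exact: gI.
Qed.

(** Zorn gives a maximal subset of [K] that is independent modulo [W]. *)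
Lemma complement_basis (W K : V -> Prop) :
  (W 0) -> (forall c x y, W x -> W y -> W (c *: x + y)) ->
  exists X : V -> Prop, [/\ forall x, X x -> K x,
    forall (s : seq V) (c : V -> F), uniq s -> (forall x, x \in s -> X x) ->
      W (\sum_(x <- s) c x *: x) -> forall x, x \in s -> c x = 0 &
    forall v, K v -> exists (s : seq V) (c : V -> F),
      (forall x, x \in s -> X x) /\ W (v - \sum_(x <- s) c x *: x)].
Proof.
move=> W0 WL.
pose indep (X : set V) := forall (s : seq V) (c : V -> F), uniq s ->
  (forall x, x \in s -> X x) -> W (\sum_(x <- s) c x *: x) ->
  forall x, x \in s -> c x = 0.
have [|X [[XK Xind] Xmax]] := @Zorn_bigcup V (fun X => (forall x, X x -> K x) /\ indep X).
  move=> C CP Ctot; split.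
    by move=> x [Y CY]; have [YK _] := CP _ CY; exact: YK.
  (* A finite nonempty list in the union of a chain already lies in one member of the chain. *)
  have sub (s : seq V) x : (forall y, y \in x :: s -> (\bigcup_(Y in C) Y)%classic y) ->
      exists2 Y, C Y & forall y, y \in x :: s -> Y y.
    elim: s x => [|z s IH] x h.
      have [Y CY Yx] := h x (mem_head _ _); exists Y => // y.
      by rewrite inE => /eqP ->.
    have [|Y CY Ys] := IH z; first by move=> y ys; apply: h; rewrite inE ys orbT.
    have [Z CZ Zx] := h x (mem_head _ _).
    case: (Ctot Y Z CY CZ) => YZ.
      by exists Z => // y; rewrite inE => /orP[/eqP ->//|/Ys/YZ].
    by exists Y => // y; rewrite inE => /orP[/eqP ->|/Ys//]; exact: YZ.
  move=> [//|z s] c us /sub[Y CY Ys]; have [_ Yind] := CP _ CY.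
  exact: Yind.
exists X; split=> // v Kv; apply: contrapT => nv.
have Xv : ~ X v.
  move=> Xv; apply: nv; exists [:: v], (fun _ => 1); split.
    by move=> x; rewrite inE => /eqP ->.
  by rewrite big_seq1 scale1r subrr.
apply: (Xmax (X `|` [set v])%classic).
  rewrite properEneq; split; last by left.
  by apply/eqP => e; apply: Xv; rewrite e; right.
split=> [x [/XK//|->//]|s c us sX Ws].
have sX' x : x \in s -> x <> v -> X x by move=> /sX[//|->].
have [vs|nvs] := boolP (v \in s); last first.
  apply: Xind => // x xs; apply: sX' => // e.
  by rewrite -e xs in nvs.
have remX x : x \in rem v s -> X x.
  by rewrite mem_rem_uniq // inE => /andP[/eqP xv xs]; exact: sX'.
rewrite (perm_big _ (perm_to_rem vs)) big_cons in Ws.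
(* A nonzero coefficient would let [v] be expressed by [X] modulo [W]. *)
have cv0 : c v = 0.
  apply: contrapT => /eqP cv; apply: nv.
  exists (rem v s), (fun x => - ((c v)^-1 * c x)); split => //.
  have := WL (c v)^-1 _ _ Ws W0; rewrite addr0 scalerDr scalerA mulVf // scale1r.
  rewrite scaler_sumr -sumrN; congr W; congr (_ + _); apply: eq_bigr => x _.
  by rewrite scalerA scaleNr opprK.
move=> x xs; have [->//|/eqP xv] := eqVneq x v.
move: Ws; rewrite cv0 scale0r [X in W X]add0r => Ws.
by apply: (Xind (rem v s)) => //; rewrite ?rem_uniq // mem_rem_uniq // inE xs andbT; apply/eqP.
Qed.

End Bases.

(* Otherwise [T] would be the union of the countably many entries of the lists
   [supp a] and of a set embedded in [S]. *)
Lemma embeds_avoiding (S T : choiceType) (supp : S -> seq T) :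
  embeds nat S -> ~ embeds T S ->
  exists2 q : S * nat -> T, injective q & forall x a, q x \notin supp a.
Proof.
move=> infS nTS; pose T1 := of_pred (fun t : T => forall a, t \notin supp a).
case: (embeds_total S T1) => [ST|[k kI]].
  have [q qI] := embeds_trans (embeds_prod_nat infS) ST.
  by exists (sval \o q) => [|x a]; [exact: inj_comp val_inj qI|exact: (of_predP (q x))].
case: nTS; apply: embeds_trans (embeds_prod_nat infS).
(* Listed elements are coded by a list and an index plus one, the others by second component 0; the
   offset keeps the two kinds apart. *)
have H (t : T) : exists x : S * nat,
    (exists a, [/\ t \in supp a, x.1 = a & x.2 = (index t (supp a)).+1]) \/
    (exists t1 : T1, sval t1 = t /\ x = (k t1, 0%N)).
  have [[a ta]|/forallNP nt] := pselect (exists a, t \in supp a).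
    by exists (a, (index t (supp a)).+1); left; exists a.
  have t1 : `[< forall a, t \notin supp a >] by apply/asboolP => a; exact/negP/nt.
  by exists (k (exist _ t t1), 0%N); right; exists (exist _ t t1).
have [f fP] := choice H; exists f => x y e.
case: (fP x) (fP y) => [[a [xa e1 e2]]|[x1 [tx e1]]] [[b [yb d1 d2]]|[y1 [ty d1]]].
- have ab : a = b by rewrite -e1 e d1.
  move: d2 yb; rewrite -ab -e e2 => -[ei] yb.
  by rewrite -[LHS](nth_index x xa) ei nth_index.
- by move: e2; rewrite e d1.
- by move: d2; rewrite -e e1.
- by move: e; rewrite e1 d1 -tx -ty => -[/kI ->].
Qed.

(** * Coordinates and the normal form of an endomorphism of small rank *)

Section Coordinates.
Variables (F : fieldType) (V : lmodType F) (I K : choiceType).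
Variables (f : {linear V -> {malg F[K]}}) (e : I -> V) (k : K).

Lemma mcoeff_lin_delta i0 (m : {malg F[I]}) :
  (forall i, (f (e i))@_k = (i == i0)%:R) -> (f (lin e m))@_k = m@_i0.
Proof.
move=> h; rewrite (@linEw _ _ _ _ (i0 |` msupp m)%fset) ?fsubsetUr //.
rewrite linear_sum raddf_sum /= (bigD1_seq i0) ?fset_uniq //=; last first.
  by rewrite !inE eqxx.
rewrite linearZ mcoeffZ h eqxx mulr1 big1 ?addr0 // => i /negbTE ni.
by rewrite linearZ mcoeffZ h ni mulr0.
Qed.

Lemma mcoeff_lin_zero (m : {malg F[I]}) :
  (forall i, (f (e i))@_k = 0) -> (f (lin e m))@_k = 0.
Proof.
move=> h; rewrite /lin linear_sum raddf_sum /= big1 // => i _.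
by rewrite linearZ mcoeffZ h mulr0.
Qed.

End Coordinates.

(** [Psi] joins a lift [c'] of a basis of the range, the inclusion [r] of the range, and kernel
    vectors: the family [h], which makes the third factor infinite-dimensional, and a complement
    [X]. *)
Lemma dominant_form (F : fieldType) (V : lmodType F) (w : {linear V -> V}) :
  rank_lt_dim w -> infinite_dim (range_of w) ->
  exists (I K : choiceType) (B : {linear {malg F[I]} -> {malg F[I]}})
    (Psi : {linear ({malg F[I]} * {malg F[I]} * {malg F[K]})%type -> V}),
    [/\ embeds nat I, embeds nat K, bijective Psi &
        forall z, w (Psi z) = Psi ((0, z.1.1 + B z.1.2), 0)].
Proof.
move=> [A [Bs [bA bB [_ nle]]]] inf.
have [Ainj Aspan] := basis_of_lin bA; have [Binj Bspan] := basis_of_lin bB.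
have infA := basis_of_infinite bA inf.
pose IA := of_pred A; pose IB := of_pred Bs.
have [kap [kapK Kkap]] := linear_inverse (bijectiveT Binj (fun v => Bspan v I)).
have kapB (b : IB) : kap (sval b) = << b >>.
  by rewrite -[RHS]kapK; congr (kap _); rewrite [RHS]linU.
have /choice[c cP] (a : IA) : exists v, w v = sval a.
  by have [AW _ _] := bA; have [v ->] := AW _ (of_predP a); exists v.
have nBA : ~ embeds IB IA.
  move=> [f fI]; apply: nle.
  have ins x : Bs x -> exists2 i : IB, sval i = x & (insub x : option IB) = Some i.
    by move=> Bx; pose i : IB := exist _ x (asboolT Bx); exists i => //; exact: (valK i).
  exists (fun v => if (insub v : option IB) is Some b then sval (f b) else v); split=> [x|x y].
    by move=> /ins[i _ ->]; exact: of_predP.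
  by move=> /ins[i <- ->] /ins[j <- ->] /val_inj/fI ->.
pose supp (a : IA) : seq IB := msupp (kap (sval a)) ++ msupp (kap (c a)).
have [q qI qS] := @embeds_avoiding IA IB supp infA nBA.
have /choice[mb mbP] (b : IB) : exists m : {malg F[IA]}, lin sval m = w (sval b).
  by apply: Aspan; exists (sval b).
have wc (m : {malg F[IA]}) : w (lin c m) = lin sval m.
  rewrite -[LHS]/((w \o lin c) m); apply: eq_malg_linear => a.
  by rewrite /= !linU cP.
(* [kb x] is the basis vector [q x], which no [sval a] or [c a] involves, pushed
   into the kernel of [w].  Adding distinct such vectors to the [c a] makes
   their span independent from the range of [w]. *)
pose kb x := sval (q x) - lin c (mb (q x)).
have wkb x : w (kb x) = 0 by rewrite linearB wc mbP subrr.
have c0 x a : (kap (c a))@_(q x) = 0.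
  by apply: mcoeff_outdom; have := qS x a; rewrite mem_cat negb_or => /andP[].
have r0 x (a : IA) : (kap (sval a))@_(q x) = 0.
  by apply: mcoeff_outdom; have := qS x a; rewrite mem_cat negb_or => /andP[].
have kb1 x y : (kap (kb y))@_(q x) = (y == x)%:R.
  rewrite linearB mcoeffB kapB mcoeffU mcoeff_lin_zero ?subr0 //.
  by rewrite (inj_eq qI).
(* The kernel vectors of second index 0 perturb the lifts; those of index 1 are kept for the third
   factor. *)
pose c' a := c a + kb (a, 0%N); pose h a := kb (a, 1%N).
pose r : IA -> V := sval.
(* The coordinates at [q (a, 0)] and [q (a, 1)] read off [m1] and [m3]; what remains is a relation
   on the basis [A]. *)
have indep m1 m2 m3 : lin c' m1 + lin r m2 + lin h m3 = 0 -> [/\ m1 = 0, m2 = 0 & m3 = 0].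
  move=> e0; have e x : (kap (lin c' m1 + lin r m2 + lin h m3))@_(q x) = 0.
    by rewrite e0 linear0 mcoeff0.
  have m10 : m1 = 0.
    apply/malgP => a; rewrite mcoeff0 -(e (a, 0%N)) !linearD !mcoeffD.
    rewrite [X in _ = _ + X + _]mcoeff_lin_zero // [X in _ = _ + _ + X]mcoeff_lin_zero.
      rewrite !addr0 (mcoeff_lin_delta (i0 := a)) // => i.
      by rewrite linearD mcoeffD c0 add0r kb1 xpair_eqE andbT.
    by move=> i; rewrite kb1 xpair_eqE andbF.
  have m30 : m3 = 0.
    apply/malgP => a; rewrite mcoeff0 -(e (a, 1%N)) m10 linear0 add0r !linearD !mcoeffD.
    rewrite [X in _ = X + _]mcoeff_lin_zero // add0r (mcoeff_lin_delta (i0 := a)) // => i.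
    by rewrite kb1 xpair_eqE andbT.
  split=> //; apply: Ainj; move: e0.
  by rewrite m10 m30 !linear0 add0r addr0.
pose W v := exists m1 m2 m3, v = lin c' m1 + lin r m2 + lin h m3.
have [||X [XK Xind Xspan]] := @complement_basis F V W (fun v => w v = 0).
- by exists 0, 0, 0; rewrite !linear0 !addr0.
- move=> k _ _ [x1 [x2 [x3 ->]]] [y1 [y2 [y3 ->]]].
  exists (k *: x1 + y1), (k *: x2 + y2), (k *: x3 + y3); rewrite !linearP.
  by module F V.
pose IX := of_pred X; pose rX : IX -> V := sval.
have [s sb] := malg_sum_bijection F IA IX.
have [s' [sK s'K]] := linear_inverse sb.
have [Psi PsiE] : exists Psi : {linear
      ({malg F[IA]} * {malg F[IA]} * {malg F[(IA + IX)%type]})%type -> V},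
    forall z, Psi z = lin c' z.1.1 + lin r z.1.2 + lin h (s' z.2).1 + lin rX (s' z.2).2.
  apply: linear_packing => k [[x1 x2] x3] [[y1 y2] y3] /=.
  by rewrite linearP /= !linearP; module F V.
have wc' (m : {malg F[IA]}) : w (lin c' m) = lin r m.
  rewrite -[LHS]/((w \o lin c') m); apply: eq_malg_linear => a.
  by rewrite /= !linU linearD cP wkb addr0.
have wh (m : {malg F[IA]}) : w (lin h m) = 0.
  rewrite /lin linear_sum big1 // => a _.
  by rewrite linearZ_LR wkb scaler0.
have wX (m : {malg F[IX]}) : w (lin rX m) = 0.
  rewrite /lin linear_sum big1 // => a _.
  by rewrite linearZ_LR (XK _ (of_predP a)) scaler0.
have /choice[b bP] (a : IA) : exists m : {malg F[IA]}, lin r m = w (r a).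
  by apply: Aspan; exists (r a).
have wr (m : {malg F[IA]}) : w (lin r m) = lin r (lin b m).
  rewrite -[LHS]/((w \o lin r) m) -[RHS]/((lin r \o lin b) m).
  by apply: eq_malg_linear => a; rewrite /= !linU bP.
exists IA, (IA + IX)%type, (lin b), Psi; split=> //.
- by have [f fI] := infA; exists (inl \o f) => x y [/fI].
- apply: bijectiveT => [|v].
    suff inj0 z : Psi z = 0 -> z = 0 by apply: raddf_inj; exact: inj0.
    case: z => -[m1 m2] n; rewrite PsiE /= => e.
    have x40 : (s' n).2 = 0.
      have [t [d [ut tX te]]] := lin_sval (s' n).2; apply; apply: Xind => //.
      rewrite -te; exists (- m1), (- m2), (- (s' n).1); rewrite !linearN.
      apply/eqP; rewrite -subr_eq0 -e; apply/eqP; module F V.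
    move: e; rewrite x40 linear0 addr0 => /indep[-> -> x30].
    congr (_, _); rewrite -(s'K n) (surjective_pairing (s' n)) x30 x40.
    exact: linear0.
  (* Subtracting the lift of [w v] puts [v] in the kernel of [w], which is spanned by [X] modulo
     [W]. *)
  have [m me] : exists m : {malg F[IA]}, lin r m = w v by apply: Aspan; exists v.
  have [|t [d [tX [m1 [m2 [m3 e]]]]]] := Xspan (v - lin c' m).
    by rewrite linearB wc' me subrr.
  have [m4 m4e] := sum_lin_sval d tX.
  exists ((m + m1, m2), s (m3, m4)); rewrite PsiE sK /= linearD.
  rewrite -[lin rX m4]/(lin sval m4) m4e.
  have -> : v = lin c' m + (v - lin c' m - \sum_(x <- t) d x *: x) + \sum_(x <- t) d x *: x.
    module F V.
  by rewrite e; module F V.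
- move=> [[m1 m2] n]; rewrite PsiE !linearD wc' wr wh wX PsiE /=.
  have -> : s' 0 = 0 by exact: linear0.
  by rewrite linear0 (linearD (lin r)) (linear0 (lin h)) (linear0 (lin rX)); module F V.
Qed.

(** * The decomposition *)

Lemma split_quadratic (F : fieldType) (p : {poly F}) : size p = 3%N -> split_poly p ->
  exists a b : F, [/\ forall (V : lmodType F) (f : V -> V), quadratic a b f ->
      forall v, peval p f v = 0,
    forall x, root p x -> (x == a) || (x == b) & ptrace p = a + b].
Proof.
move=> sp [s ps]; pose l := lead_coef p.
have l0 : l != 0 by rewrite lead_coef_eq0 -size_poly_eq0 sp.
have : size p = (size s).+1 by rewrite ps size_scale // size_prod_XsubC.
rewrite sp; case: s ps => [|a [|b [|? ?]]] // + _; rewrite -/l big_cons big_seq1 => ps.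
have pE : p = l *: ('X^2 - (a + b) *: 'X + (a * b)%:P).
  by rewrite ps -!mul_polyC polyCD polyCM; ring.
have pc2 : p`_2 = l by rewrite pE !coefE /= ; ring.
have pc1 : p`_1 = - (l * (a + b)) by rewrite pE !coefE /=; ring.
have pc0 : p`_0 = l * (a * b) by rewrite pE !coefE /=; ring.
exists a, b; split.
- move=> V f q v; rewrite /peval sp !big_ord_recl big_ord0 /= pc0 pc1 pc2 q.
  by module F V.
- by move=> x; rewrite ps rootZ // rootM !root_XsubC.
- by rewrite /ptrace sp pc1 -/l mulNr mulrAC divff // mul1r opprK.
Qed.

(** Interleaving even and odd positions identifies the space with a square, where the block
    criterion with [g] the identity reads as the trace equation. *)
Lemma qsum3_half_trace (F : fieldType) (a1 b1 a2 b2 a3 b3 lambda : F) (K : choiceType) :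
  embeds nat K -> 2%:R * lambda = a1 + b1 + (a2 + b2) + (a3 + b3) ->
  qsum3 a1 b1 a2 b2 a3 b3 (fun m : {malg F[K]} => lambda *: m).
Proof.
move=> /nat_partition[J [th thb]] tr.
pose L := (J * nat)%type; pose ev (x : L + L) : L :=
  match x with inl (j, n) => (j, n.*2) | inr (j, n) => (j, n.*2.+1) end.
have evb : bijective ev.
  apply: bijectiveT => [[[i m]|[i m]] [[j n]|[j n]] /= [-> e]|[j n]].
  - by rewrite (double_inj e).
  - by move/(congr1 odd): e; rewrite /= !odd_double.
  - by move/(congr1 odd): e; rewrite /= !odd_double.
  - by rewrite (double_inj e).
  case on : (odd n).
    by exists (inr (j, n./2)); rewrite /= -[in RHS](odd_double_half n) on.
  by exists (inl (j, n./2)); rewrite /= -[in RHS](odd_double_half n) on.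
have [f fb] := malg_sum_bijection F L L.
have gb := lin_bijective F (bij_comp thb evb).
have [sc scE] : exists sc : {linear {malg F[L]} -> {malg F[L]}}, sc =1 ( *:%R lambda).
  by apply: linear_packing => c u v; module F {malg F[L]}.
apply: (@qsum3_iso _ _ _ _ _ _ _ _ _ (lin (fun i => << (th \o ev) i >>) \o f)
   (fun z => (sc z.1 + 0, 0 + sc z.2))).
- exact: bij_comp gb fb.
- move=> [x y]; rewrite /= !scE addr0 add0r.
  by rewrite -[(_, _)]/(lambda *: (x, y)) !linearZ_LR.
apply: (@qsum3_block _ _ _ _ _ _ _ _ sc \0 \0 sc idfun); first by exists idfun.
move=> x; rewrite /= !scE -scalerDl; congr (_ *: _).
by rewrite -mulr2n -mulr_natl tr; ring.
Qed.

(** Conjugation by the shear [S] gives the blocks [lambda + T], [T (B - T)], the identity and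
    [lambda + B - T]. The block criterion becomes [g T = (T - B') g], where [B'] is [B] plus the
    scalar [2 lambda] minus the trace sum. *)
Lemma qsum3_dominant (F : fieldType) (a1 b1 a2 b2 a3 b3 lambda : F) (I : choiceType)
    (B : {linear {malg F[I]} -> {malg F[I]}}) : embeds nat I ->
  qsum3 a1 b1 a2 b2 a3 b3 (fun z : {malg F[I]} * {malg F[I]} =>
    (lambda *: z.1, lambda *: z.2 + (z.1 + B z.2))).
Proof.
move=> infI; pose M := {malg F[I]}.
have [B' B'E] : exists B' : {linear M -> M}, forall m,
    B' m = B m + (lambda + lambda - (a1 + b1 + a2 + b2 + a3 + b3)) *: m.
  by apply: linear_packing => c u v; rewrite linearP; module F M.
have [T [g [gb gT]]] := difference_of_similar B' infI.
have [al alE] : exists al : {linear M -> M}, forall m, al m = lambda *: m + T m.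
  by apply: linear_packing => c u v; rewrite (linearP T); module F M.
have [be beE] : exists be : {linear M -> M}, forall m, be m = T (B m - T m).
  apply: linear_packing => c u v; rewrite -linearP; congr (T _).
  by rewrite (linearP B) (linearP T); module F M.
have [de deE] : exists de : {linear M -> M}, forall m, de m = lambda *: m + (B m - T m).
  by apply: linear_packing => c u v; rewrite (linearP B) (linearP T); module F M.
have [S SE] : exists S : {linear (M * M)%type -> (M * M)%type},
    forall z, S z = (z.1 - T z.2, z.2).
  by apply: linear_packing => c [x y] [x' y']; congr pair; rewrite /= linearP; module F M.
apply: (@qsum3_iso _ _ _ _ _ _ _ _ _ S (fun z => (al z.1 + be z.2, z.1 + de z.2))).
- exists (fun z => (z.1 + T z.2, z.2)) => -[x y]; rewrite SE /=; congr pair.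
    exact: subrK.
  exact: addrK.
- move=> [x y]; rewrite !SE /= alE beE deE; congr pair; last by module F M.
  by rewrite !linearD !linearN !linearZ_LR /=; module F M.
apply: (@qsum3_block _ _ _ _ _ _ _ _ al be idfun de g) => // x.
by rewrite alE deE linearD linearZ_LR gT B'E; module F M.
Qed.

Theorem theorem4 (F : fieldType) (V : lmodType F) (p1 p2 p3 : {poly F})
  (u : {linear V -> V}) (lambda : F) :
  infinite_dim (fun _ : V => True) ->
  size p1 = 3%N -> size p2 = 3%N -> size p3 = 3%N ->
  split_poly p1 -> split_poly p2 -> split_poly p3 ->
  dominant_eigenvalue u lambda ->
  infinite_dim (range_of (shift u lambda)) ->
  scalar_sum3 p1 p2 p3 lambda \/ 2%:R * lambda = ptrace p1 + ptrace p2 + ptrace p3 ->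
  is_sum3 p1 p2 p3 u.
Proof.
move=> _ s1 s2 s3 sp1 sp2 sp3 dom inf cond.
have [a1 [b1 [q1 r1 t1]]] := split_quadratic s1 sp1.
have [a2 [b2 [q2 r2 t2]]] := split_quadratic s2 sp2.
have [a3 [b3 [q3 r3 t3]]] := split_quadratic s3 sp3.
have [w wE] : exists w : {linear V -> V}, w =1 shift u lambda.
  by apply: linear_packing => c x y; rewrite /shift linearP; module F V.
have we : (w : V -> V) = shift u lambda by apply: funext.
rewrite /dominant_eigenvalue -we in dom; rewrite -we in inf.
have [I [K [B [Psi [infI infK Psib Psiw]]]]] := dominant_form dom inf.
suff [u1 [u2 [u3 [uE e1 e2 e3]]]] : qsum3 a1 b1 a2 b2 a3 b3 u.
  exists u1, u2, u3; split=> //; [exact: q1|exact: q2|exact: q3].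
pose uK (m : {malg F[K]}) := lambda *: m.
apply: (qsum3_iso (u := prod_map (fun z : {malg F[I]} * {malg F[I]} =>
    (lambda *: z.1, lambda *: z.2 + (z.1 + B z.2))) uK) Psib).
  move=> [[x y] n]; have -> : u (Psi (x, y, n)) = lambda *: Psi (x, y, n) + w (Psi (x, y, n)).
    by rewrite wE /shift addrC subrK.
  rewrite Psiw -linearP /=; congr (Psi _); congr (_, _); last by rewrite /= addr0.
  by congr (_, _); rewrite /= addr0.
(* The alternative on [lambda] serves for the scalar factor. *)
apply: qsum3_prod; first exact: qsum3_dominant.
case: cond => [[x1 [x2 [x3 [/r1 h1 /r2 h2 /r3 h3 e]]]]|tr].
  by rewrite /uK e; exact: qsum3_scalar.
by apply: qsum3_half_trace => //; rewrite tr t1 t2 t3.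
Qed.
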